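(* There exists a robust MDP $(\mathcal{S},\mathcal{A},\boldsymbol{r},\mathcal{U},\boldsymbol{p}_0)$ with an s-rectangular, compact, polyhedral uncertainty set $\mathcal{U}$ such that there is no Blackwell optimal policy: for all $\pi\in\Pi_{\sf H}$ and all $\gamma\in(0,1)$, there exists $\gamma'\in(\gamma,1)$ such that $$\min_{\boldsymbol{P}\in\mathcal{U}}R_{\gamma'}(\pi,\boldsymbol{P})<\sup_{\pi'\in\Pi_{\sf H}}\ \min_{\boldsymbol{P}\in\mathcal{U}}R_{\gamma'}(\pi',\boldsymbol{P}).$$
   Context: A robust MDP (RMDP) is a tuple $(\mathcal{S},\mathcal{A},\boldsymbol{r},\mathcal{U},\boldsymbol{p}_0)$: $\mathcal{S}$ (states) and $\mathcal{A}$ (actions) are finite nonempty sets, $\boldsymbol{r}\in\mathbb{R}^{\mathcal{S}\times\mathcal{A}\times\mathcal{S}}$ is the reward function, the uncertainty set $\mathcal{U}\subset\Delta(\mathcal{S})^{\mathcal{S}\times\mathcal{A}}$ is a nonempty compact set of transition probabilities $\boldsymbol{P}=(\boldsymbol{p}_{sa})_{s,a}$, and $\boldsymbol{p}_0\in\Delta(\mathcal{S})$ is the initial distribution. The set $\mathcal{U}$ is s-rectangular if $\mathcal{U}=\prod_{s\in\mathcal{S}}\mathcal{U}_s$ with $\mathcal{U}_s\subseteq\Delta(\mathcal{S})^{\mathcal{A}}$. $\Pi_{\sf H}$ is the set of history-dependent, possibly randomized policies (the distribution of $a_t$ may depend on $(s_0,a_0,\dots,s_t)$). For $\gamma\in(0,1)$,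 the discounted return is $$R_\gamma(\pi,\boldsymbol{P})=\mathbb{E}_{\pi,\boldsymbol{P}}\Big[\sum_{t=0}^{+\infty}\gamma^t r_{s_ta_ts_{t+1}}\ \Big|\ s_0\sim\boldsymbol{p}_0\Big],$$ where $\mathbb{E}_{\pi,\boldsymbol{P}}$ is expectation with respect to the law of $(s_t,a_t)_{t\ge 0}$ induced by $\pi$ and $\boldsymbol{P}$. A policy $\pi\in\Pi_{\sf H}$ is Blackwell optimal if there exists $\gamma_0\in(0,1)$ such that $\inf_{\boldsymbol{P}\in\mathcal{U}}R_\gamma(\pi,\boldsymbol{P})\ge\sup_{\pi'\in\Pi_{\sf H}}\inf_{\boldsymbol{P}\in\mathcal{U}}R_\gamma(\pi',\boldsymbol{P})$ for all $\gamma\in(\gamma_0,1)$. *)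

(* Defs.v *)
From HB Require Import structures.
From mathcomp Require Import all_boot all_order all_algebra.
From mathcomp Require Import all_classical all_reals all_analysis.

Set Implicit Arguments.
Unset Strict Implicit.
Unset Printing Implicit Defensive.

Import Order.TTheory GRing.Theory Num.Theory.
Import numFieldNormedType.Exports.

Local Open Scope classical_set_scope.
Local Open Scope ring_scope.

Record dist (R : realType) (T : finType) := Dist {
  dist_val :> T -> R;
  dist_ge0 : forall x, 0 <= dist_val x;
  dist_sum1 : \sum_x dist_val x = 1 }.

(* Sequences over X. The parameter x0 only serves to make the type pointed,
   as measurableType requires. *)
Definition path_space (X : finType) (x0 : X) : Type := nat -> X.

HB.instance Definition _ (X : finType) (x0 : X) :=
  Choice.copy (path_space x0) (nat -> X).
HB.instance Definition _ (X : finType) (x0 : X) :=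
  isPointed.Build (path_space x0) (fun=> x0).

Definition cylinders (X : finType) (x0 : X) : set (set (path_space x0)) :=
  [set C | exists t x, C = [set w | w t = x]].
Arguments cylinders {X} x0.

(* The product sigma-algebra of the discrete sigma-algebras. *)
Notation path_type x0 := (g_sigma_algebraType (cylinders x0)).

(* mu is the law of a sequence whose next element, given the prefix h,
   is distributed according to q h. *)
Definition is_path_law (R : realType) (X : finType) (x0 : X)
    (q : seq X -> dist R X) (mu : probability (path_type x0) R) : Prop :=
  forall (w : path_type x0) (n : nat),
    mu [set w' | forall t, (t < n)%N -> w' t = w t] =
    (\prod_(t < n) q (mkseq w t) (w t))%:E.

Section path_law_existence.
Context (R : realType) (X : finType) (x0 : X) (q : seq X -> dist R X).

(* The law is the image of the Lebesgue measure on [0, 1[, where the prefix s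
   (stored in reverse) corresponds to the interval cell s of length prob s. *)

Let off (h : seq X) (x : X) : R :=
  \sum_(y | (enum_rank y < enum_rank x)%N) q h y.

Let prob := fix prob (s : seq X) : R :=
  if s is x :: s' then prob s' * q (rev s') x else 1.

Let left := fix left (s : seq X) : R :=
  if s is x :: s' then left s' + prob s' * off (rev s') x else 0.

Let cell (s : seq X) : set R := [set` `[left s, left s + prob s[].

Let prob_ge0 s : 0 <= prob s.
Proof. by elim: s => //= x s IH; rewrite mulr_ge0 // dist_ge0. Qed.

Let off_ge0 h x : 0 <= off h x.
Proof. by rewrite sumr_ge0 // => y _; exact: dist_ge0. Qed.

Let offS h x y : (enum_rank x < enum_rank y)%N -> off h x + q h x <= off h y.
Proof.
move=> xy; rewrite /off [leRHS](bigD1 x xy) /= [leRHS]addrC lerD2r.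
rewrite [leLHS]big_mkcond [leRHS]big_mkcond /=; apply: ler_sum => z _.
case: ifPn => zx; last by case: ifP => // _; exact: dist_ge0.
rewrite (ltn_trans zx xy) /=; case: eqP => // zxE.
by rewrite zxE ltnn in zx.
Qed.

Let off_le1 h x : off h x + q h x <= 1.
Proof.
rewrite -(dist_sum1 (q h)) (bigD1 x) //= [leRHS]addrC lerD2r /off.
rewrite [leLHS]big_mkcond [leRHS]big_mkcond /=; apply: ler_sum => z _.
case: ifPn => zx; last by case: ifP => // _; exact: dist_ge0.
by case: eqP => // zxE; rewrite zxE ltnn in zx.
Qed.

Let cell_cons x s : cell (x :: s) `<=` cell s.
Proof.
move=> u; rewrite /cell /= !in_itv /= => /andP[lu ul]; apply/andP; split.
  by apply: le_trans lu; rewrite lerDl mulr_ge0 ?prob_ge0 ?off_ge0.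
apply: (lt_le_trans ul); rewrite -addrA lerD2l -mulrDr.
by rewrite -[leRHS]mulr1 ler_wpM2l ?prob_ge0 ?off_le1.
Qed.

Let cell_inj s s' u : size s = size s' -> cell s u -> cell s' u -> s = s'.
Proof.
elim: s s' => [|x s IH] [|y s'] //= [ss'] cs cs'.
have E : s = s' by apply: IH => //; [exact: cell_cons cs|exact: cell_cons cs'].
subst s'; congr (_ :: _); apply/enum_rank_inj/val_inj/eqP.
move: cs cs'; rewrite /cell /= !in_itv /= => /andP[l1 r1] /andP[l2 r2].
have aux a b : (enum_rank a < enum_rank b)%N ->
    left s + prob s * off (rev s) a + prob s * q (rev s) a <=
    left s + prob s * off (rev s) b.
  move=> ab; rewrite -addrA -mulrDr lerD2l ler_wpM2l ?prob_ge0 //.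
  exact: offS.
case: ltngtP => // xy.
- by have := lt_le_trans r1 (le_trans (aux _ _ xy) l2); rewrite ltxx.
- by have := lt_le_trans r2 (le_trans (aux _ _ xy) l1); rewrite ltxx.
Qed.

Let cell_split s u : cell s u -> exists x, cell (x :: s) u.
Proof.
rewrite /cell /= in_itv /= => /andP[lu ul].
pose F k := \sum_(y : X | (enum_rank y < k)%N) q (rev s) y.
have F0 : F 0%N = 0 by rewrite /F big_pred0.
have F1 : F #|X| = 1.
  by rewrite /F -(dist_sum1 (q (rev s))); apply: eq_bigl => y; rewrite ltn_ord.
have exk : exists k, u < left s + prob s * F k.
  by exists #|X|; rewrite F1 mulr1.
case: (ex_minnP exk) => [[|k]]; first by rewrite F0 mulr0 addr0 ltNge lu.
move=> uk kmin.
have kX : (k < #|X|)%N by apply: (kmin #|X|); rewrite F1 mulr1.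
have [x rx] : exists x : X, enum_rank x = k :> nat.
  by exists (enum_val (Ordinal kX)); rewrite enum_valK.
have FS : F k.+1 = F k + q (rev s) x.
  rewrite /F (bigD1 x) /=; last by rewrite rx.
  rewrite addrC; congr (_ + _); apply: eq_bigl => y.
  rewrite ltnS leq_eqVlt; case: eqP => [yk|yk].
    have -> : y = x by apply/enum_rank_inj/val_inj; rewrite /= yk rx.
    by rewrite eqxx rx ltnn.
  case: eqP => [e|]; last by rewrite andbT.
  by case: yk; rewrite e.
exists x; have offE : off (rev s) x = F k by rewrite /off rx.
rewrite /= in_itv /= offE -addrA -mulrDr -FS uk andbT leNgt.
by apply/negP => /kmin; rewrite ltnn.
Qed.

Let choice (s : seq X) (u : R) : X := odflt x0 [pick x | u \in cell (x :: s)].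

Let hist (u : R) := fix hist (n : nat) : seq X :=
  if n is n'.+1 then choice (hist n') u :: hist n' else [::].

Let path (u : measurableTypeR R) : path_type x0 := fun n => choice (hist u n) u.

Let size_hist u n : size (hist u n) = n.
Proof. by elim: n => //= n ->. Qed.

Let hist_cell u n : cell [::] u -> cell (hist u n) u.
Proof.
move=> u01; elim: n => //= n /cell_split [x xu].
rewrite {1}/choice; case: pickP => [y|/(_ x)]; first by rewrite inE.
by move/negbT; rewrite notin_setE.
Qed.

Let histE (w : nat -> X) u n :
  (forall t, (t < n)%N -> path u t = w t) <-> hist u n = rev (mkseq w n).
Proof.
elim: n => [|n IH]; first by split.
have -> : rev (mkseq w n.+1) = w n :: rev (mkseq w n).
  by rewrite /mkseq -addn1 iotaD map_cat rev_cat.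
split => [H|/= [Hn /IH Hh] t].
  rewrite /= -(H n) //; congr (_ :: _).
  by apply/IH => t tn; apply: H; rewrite ltnS ltnW.
by rewrite ltnS leq_eqVlt => /predU1P[->//|]; exact: Hh.
Qed.

Let measurable_cell s : measurable (cell s).
Proof. exact: measurable_itv. Qed.

Let measurable_choice s x : measurable [set u | choice s u = x].
Proof.
have -> : [set u | choice s u = x] =
    cell (x :: s) `|` (if x == x0 then ~` \bigcup_y cell (y :: s) else set0).
  apply/seteqP; split => u /=.
    rewrite /choice; case: pickP => [y|n] /=; first by rewrite inE => ? <-; left.
    move=> <-; right; rewrite eqxx => -[y _].
    by have := negbT (n y); rewrite notin_setE.
  rewrite /choice; case: pickP => [y|n] /=.
    rewrite inE => yu [xu|].
      by have [] := cell_inj (erefl _ : size (y :: s) = size (x :: s)) yu xu.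
    by case: ifP => // _ []; exists y.
  case=> [xu|]; last by case: eqP.
  by have := negbT (n x); rewrite notin_setE.
apply: measurableU; first exact: measurable_cell.
case: ifP => // _; apply: measurableC; apply: fin_bigcup_measurable => //.
Qed.

Let measurable_hist n s : measurable [set u | hist u n = s].
Proof.
elim: n s => [|n IH] [|x s] /=.
- by rewrite (_ : [set _ | _] = setT) //; apply/seteqP.
- by rewrite (_ : [set _ | _] = set0) //; apply/seteqP; split.
- by rewrite (_ : [set _ | _] = set0) //; apply/seteqP; split.
rewrite (_ : [set _ | _] = [set u | choice s u = x] `&` [set u | hist u n = s]).
  by apply: measurableI; [exact: measurable_choice|exact: IH].
by apply/seteqP; split => u /= [] => [<- <-|<- <-].
Qed.

Let measurable_path : measurable_fun setT path.
Proof.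
apply: (@measurability _ _ _ (path_type x0) _ _ (cylinders x0)) => //.
move=> _ [_ [t [x ->]] <-]; rewrite setTI.
rewrite (_ : _ @^-1` _ = \bigcup_(s : seq X)
    ([set u | hist u t = s] `&` [set u | choice s u = x])).
  apply: countable_bigcupT_measurable; first exact: countableP.
  by move=> s; apply: measurableI;
    [exact: measurable_hist|exact: measurable_choice].
apply/seteqP; split => u /=; first by move=> <-; exists (hist u t).
by case=> s _ /= [<-].
Qed.

Let m01 : measurable (cell [::]). Proof. exact: measurable_cell. Qed.

Let base : set (measurableTypeR R) -> \bar R := mrestr lebesgue_measure m01.

Let base_setT : base [set: _] = 1%:E.
Proof.
rewrite /base /mrestr setTI /cell /= lebesgue_measure_itv /= lte_fin add0r.
by rewrite ltr01 sube0.
Qed.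

HB.instance Definition _ := Measure.on base.
HB.instance Definition _ := Measure_isProbability.Build _ _ _ base base_setT.
HB.instance Definition _ :=
  isMeasurableFun.Build _ _ _ (path_type x0) path measurable_path.

Lemma path_law_ex : exists mu, @is_path_law R X x0 q mu.
Proof.
exists (distribution base path) => w n.
rewrite /distribution /= /pushforward /base /mrestr.
set s := rev (mkseq w n).
rewrite (_ : _ `&` _ = cell s).
  have -> : cell s = [set` `[left s, left s + prob s[] by [].
  rewrite lebesgue_measure_itv /= lte_fin ltrDl.
  have -> : \prod_(t < n) q (mkseq w t) (w t) = prob s.
    rewrite /s; elim: n @s => [|n IH]; first by rewrite big_ord0.
    rewrite big_ord_recr /= IH.
    have -> : rev (mkseq w n.+1) = w n :: rev (mkseq w n).
      by rewrite /mkseq -addn1 iotaD map_cat rev_cat.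
    by rewrite /= revK.
  case: ltP => p0; first by rewrite -EFinB addrAC subrr add0r.
  by congr (_%:E); apply/le_anti; rewrite p0 prob_ge0.
apply/seteqP; split => u.
  case=> /= /histE hu u01; rewrite -/s in hu.
  by rewrite -hu; exact: hist_cell.
move=> us; have u01 : cell [::] u.
  by move: us; elim: (s) => // x s' IH /cell_cons /IH.
split => //=; apply/histE.
by apply: (cell_inj _ (hist_cell _ u01) us); rewrite size_hist size_rev size_mkseq.
Qed.

End path_law_existence.

Definition transitions (R : realType) (S A : finType) : Type :=
  S -> A -> dist R S.

(* Transition probabilities as a point of the product space R^(S x A x S). *)
Definition coords (R : realType) (S A : finType) (P : transitions R S A) :
    {ptws S * A * S -> R} :=
  fun k => P k.1.1 k.1.2 k.2.

Record rmdp (R : realType) := Rmdp {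
  states : finType;
  actions : finType;
  states_gt0 : (0 < #|states|)%N;
  actions_gt0 : (0 < #|actions|)%N;
  reward : states -> actions -> states -> R;
  uncertainty : set (transitions R states actions);
  uncertainty_neq0 : uncertainty !=set0;
  uncertainty_compact : compact (@coords R states actions @` uncertainty);
  init : dist R states }.
Arguments reward {R} M : rename.
Arguments uncertainty {R} M : rename.
Arguments init {R} M : rename.

Section robust_mdp.
Context (R : realType) (M : rmdp R).
Local Notation S := (states M).
Local Notation A := (actions M).

Definition s_rectangular : Prop :=
  exists Us : S -> set (A -> dist R S),
    uncertainty M = [set P | forall s, Us s (P s)].

Definition polyhedral : Prop :=
  exists (m : nat) (c : 'I_m -> S * A * S -> R) (b : 'I_m -> R),
    @coords R S A @` uncertainty M =
    [set x | forall i, \sum_k c i k * x k <= b i].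

(* pi [:: (s_0, a_0); ...; (s_(t-1), a_(t-1))] s_t is the distribution of a_t. *)
Definition policy : Type := seq (S * A) -> S -> dist R A.

Definition next_state (P : transitions R S A) (h : seq (S * A)) : dist R S :=
  if h is x :: h' then P (last x h').1 (last x h').2 else init M.

Definition step_val (pi : policy) (P : transitions R S A) (h : seq (S * A))
    (x : S * A) : R :=
  next_state P h x.1 * pi h x.1 x.2.

Lemma step_ge0 pi P h x : 0 <= step_val pi P h x.
Proof. by rewrite mulr_ge0 ?dist_ge0. Qed.

Lemma step_sum1 pi P h : \sum_x step_val pi P h x = 1.
Proof.
rewrite -(pair_bigA _ (fun s a => step_val pi P h (s, a))) /=.
rewrite -[RHS](dist_sum1 (next_state P h)); apply: eq_bigr => s _.
under eq_bigr do rewrite /step_val /=.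
by rewrite -mulr_sumr dist_sum1 mulr1.
Qed.

Definition step pi P h : dist R (S * A)%type :=
  Dist (step_ge0 pi P h) (step_sum1 pi P h).

Definition point0 : S * A :=
  (enum_val (Ordinal (states_gt0 M)), enum_val (Ordinal (actions_gt0 M))).

(* The law of (s_t, a_t)_(t >= 0); is_path_law determines it uniquely since
   the prefix events are a pi-system generating the sigma-algebra. *)
Definition traj_law (pi : policy) (P : transitions R S A) :
    probability (path_type point0) R :=
  projT1 (cid (path_law_ex point0 (step pi P))).

Definition discounted_return (gamma : R) (pi : policy)
    (P : transitions R S A) : \bar R :=
  'E_(traj_law pi P)[fun w =>
    limn [series gamma ^+ t * reward M (w t).1 (w t).2 (w t.+1).1]_t].

Definition worst_return (gamma : R) (pi : policy) : \bar R :=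
  ereal_inf [set discounted_return gamma pi P | P in uncertainty M].

Definition optimal_return (gamma : R) : \bar R :=
  ereal_sup [set worst_return gamma pi | pi in [set: policy]].

Definition blackwell_optimal (pi : policy) : Prop :=
  exists gamma0 : R, 0 < gamma0 < 1 /\
    forall gamma : R, gamma0 < gamma < 1 ->
      (optimal_return gamma <= worst_return gamma pi)%E.

End robust_mdp.

(* Main.v *)
(* From the initial state, whatever the action, the adversary chooses with one
   probability l between the absorbing state and a state that pays 1 one step
   later. With rewards 1 and -1 for the action [true] (and 0 for [false]) on
   these two transitions, a policy that plays [true] first with probability p
   returns l p + (1 - l) (gamma - p), so its worst return is min(p, gamma - p).
   This is maximal, with value gamma / 2, only at p = gamma / 2, and a fixed p
   satisfies this equation for at most one gamma. *)
Require Import Defs.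
From HB Require Import structures.
From mathcomp Require Import all_boot all_order all_algebra.
From mathcomp Require Import all_classical all_reals all_analysis.
From mathcomp Require Import measurable_realfun.
From mathcomp Require Import ring lra.

Set Implicit Arguments.
Unset Strict Implicit.
Unset Printing Implicit Defensive.

Import Order.TTheory GRing.Theory Num.Theory.
Import numFieldNormedType.Exports.

Local Open Scope classical_set_scope.
Local Open Scope ring_scope.

(** * Path laws: null transitions and expectations over finite prefixes *)

Section path_law.
Context (R : realType) (X : finType) (x0 : X).

Lemma measurable_coord (t : nat) (x : X) :
  measurable [set w : path_type x0 | w t = x].
Proof. by apply: sub_sigma_algebra; exists t, x. Qed.

Lemma measurable_prefix (n : nat) (h : seq X) :
  measurable [set w : path_type x0 | mkseq w n = h].
Proof.
have [hn|hn] := eqVneq (size h) n; last first.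
  rewrite (_ : [set _ | _] = set0) //; apply/seteqP; split => // w /= E.
  by move: hn; rewrite -E size_mkseq eqxx.
rewrite (_ : [set _ | _] =
    \bigcap_(t in `I_n) [set w : path_type x0 | w t = nth x0 h t]).
  by apply: bigcap_measurableType => t _; exact: measurable_coord.
apply/seteqP; split => w /=.
  by move=> <- t /= tn; rewrite nth_mkseq.
move=> wh; apply: (@eq_from_nth _ x0); rewrite size_mkseq // => t tn.
by rewrite nth_mkseq // wh.
Qed.

(** [seq X] is countable, so every preimage is a countable union of prefix events. *)
Lemma measurable_fun_prefix (n : nat) (G : seq X -> R) :
  measurable_fun setT (fun w : path_type x0 => G (mkseq w n)).
Proof.
move=> _ B _; rewrite setTI.
rewrite (_ : _ @^-1` _ = \bigcup_(h : seq X)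
    (if G h \in B then [set w : path_type x0 | mkseq w n = h] else set0)).
  apply: countable_bigcupT_measurable; first exact: countableP.
  by move=> h; case: ifP => // _; exact: measurable_prefix.
apply/seteqP; split => w /=.
  by move=> Bw; exists (mkseq w n) => //; rewrite ifT // inE.
by case=> h _; case: ifPn => //=; rewrite inE => ? ->.
Qed.

Context (q : seq X -> dist R X) (mu : probability (path_type x0) R)
  (mu_law : is_path_law q mu).

(** A prefix followed by an element of mass zero is a null event, and there are only countably many
    such events, enumerated here by [unpickle]. *)
Lemma path_law_ae_neq0 :
  {ae mu, forall w : path_type x0, forall n, q (mkseq w n) (w n) != 0}.
Proof.
pose F k : set (path_type x0) :=
  if unpickle k is Some (h, x) then
    if q h x == 0 then [set w | mkseq w (size h).+1 = rcons h x] else set0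
  else set0.
have F0 k : mu.-negligible (F k).
  rewrite /F; case: unpickle => [[h x]|]; last exact: negligible_set0.
  case: eqP => [qhx|_]; last exact: negligible_set0.
  exists [set w | mkseq w (size h).+1 = rcons h x]; split => //.
    exact: measurable_prefix.
  have hE : mkseq (nth x0 (rcons h x)) (size h).+1 = rcons h x.
    by rewrite -(size_rcons h x) mkseq_nth.
  (* The law is evaluated along an infinite path, so the prefix is continued by the default [x0];
     the last factor of the product is then [q h x = 0]. *)
  rewrite (_ : [set _ | _] = [set w | forall t, (t < (size h).+1)%N ->
      w t = nth x0 (rcons h x) t]).
    rewrite mu_law big_ord_recr /= nth_rcons ltnn eqxx.
    have -> : mkseq (nth x0 (rcons h x)) (size h) = h.
      by move: hE; rewrite mkseqS => /rcons_inj[].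
    by rewrite qhx mulr0.
  rewrite -hE; apply/seteqP; split => w /=.
    by move=> E t th; have := congr1 (nth x0 ^~ t) E; rewrite !nth_mkseq.
  move=> E; apply/eq_in_map => t; rewrite mem_iota => /andP[_ th].
  by rewrite E // hE.
apply: negligibleS (negligible_bigcup F0) => w /=.
move=> /existsNP [n /negP/negPn/eqP qn].
exists (pickle (mkseq w n, w n)) => //; rewrite /F pickleK qn eqxx /=.
by rewrite size_mkseq mkseqS.
Qed.

(** The integrand is a finite combination of indicators of prefixes of length 2. *)
Lemma expectation_prefix2 (G : X -> X -> R) :
  ('E_mu[fun w => G (w 0%N) (w 1%N)])%E =
  (\sum_x q [::] x * \sum_y q [:: x] y * G x y)%:E.
Proof.
pose C (z : X * X) : set (path_type x0) := [set w | mkseq w 2 = [:: z.1; z.2]].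
have mC z : measurable (C z) by exact: measurable_prefix.
have muC z : mu (C z) = (q [::] z.1 * q [:: z.1] z.2)%:E.
  pose v := nth x0 [:: z.1; z.2].
  rewrite (_ : C z = [set w | forall t, (t < 2)%N -> w t = v t]).
    by rewrite (mu_law v) 2!big_ord_recr big_ord0 /= mul1r.
  rewrite /v; apply/seteqP; split => w /=.
    by move=> [<- <-] [|[|]].
  by move=> E; rewrite /C /= /mkseq /= !E.
rewrite unlock.
transitivity (\int[mu]_w \sum_z ((G z.1 z.2)%:E * (\1_(C z) w)%:E))%E.
  apply: eq_integral => w _; rewrite (bigD1 (w 0%N, w 1%N)) //= big1 ?adde0.
    by rewrite indicE mem_set ?mule1.
  move=> [x y] zw; rewrite indicE memNset ?mule0 //.
  by rewrite /C /= => -[xE yE]; rewrite -xE -yE eqxx in zw.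
have iC z : mu.-integrable setT (fun w => (\1_(C z) w)%:E).
  exact: integrable_indic.
rewrite integral_sum //; last by move=> z; exact: integrableZl.
have intC z : (\int[mu]_w (\1_(C z) w)%:E = (q [::] z.1 * q [:: z.1] z.2)%:E)%E.
  by rewrite integral_indic // setIT; exact: muC.
under eq_bigr do rewrite integralZl // intC -EFinM.
rewrite sumEFin; congr (_%:E).
rewrite -(pair_bigA _ (fun x y => G x y * (q [::] x * q [:: x] y))) /=.
apply: eq_bigr => x _; rewrite mulr_sumr; apply: eq_bigr => y _.
by rewrite mulrC -mulrA.
Qed.

End path_law.

(** * Discounted series, and returns determined by the first transition *)

Lemma cvg_discounted (R : realType) (gamma B : R) (u : R^nat) :
  0 < gamma < 1 -> (forall t, `|u t| <= B) ->
  cvgn [series gamma ^+ t * u t]_t.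
Proof.
move=> /andP[g0 g1] uB; apply: normed_cvg.
apply: (@series_le_cvg _ _ (geometric B gamma)) => [t|t|t|].
- exact: normr_ge0.
- by rewrite mulr_ge0 ?exprn_ge0 ?(ltW g0) // (le_trans _ (uB 0%N)).
- rewrite /= normrM normrX (gtr0_norm g0) mulrC.
  by rewrite ler_wpM2r // exprn_ge0 // ltW.
- by apply: is_cvg_geometric_series; rewrite gtr0_norm.
Qed.

Section returns.
Context (R : realType) (M : rmdp R).
Local Notation S := (states M).
Local Notation A := (actions M).

Lemma measurable_discounted_sum (gamma : R) : 0 < gamma < 1 ->
  measurable_fun setT (fun w : path_type (point0 M) =>
    limn [series gamma ^+ t * reward M (w t).1 (w t).2 (w t.+1).1]_t).
Proof.
move=> g01.
pose u (w : path_type (point0 M)) t := reward M (w t).1 (w t).2 (w t.+1).1.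
apply: (@measurable_fun_cvg _ _ _ setT
    (fun n w => [series gamma ^+ t * u w t]_t n)) => [n|w _]; last first.
  pose r (k : S * A * S) := reward M k.1.1 k.1.2 k.2.
  apply: (@cvg_discounted _ _ (\sum_k `|r k|)) => // t.
  pose k0 := (w t, (w t.+1).1).
  by rewrite (bigD1 k0) //= lerDl sumr_ge0.
rewrite /series /=; apply: measurable_sum => t.
pose G (h : seq (S * A)) : R := gamma ^+ t *
  reward M (nth (point0 M) h t).1 (nth (point0 M) h t).2
           (nth (point0 M) h t.+1).1.
(* The term of index [t] reads the state at time [t + 1], hence a prefix of length [t + 2]. *)
apply: (eq_measurable_fun (fun w : path_type (point0 M) => G (mkseq w t.+2))).
  by move=> w _; rewrite /G !nth_mkseq.
exact: measurable_fun_prefix.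
Qed.

Lemma next_state_rcons (P : transitions R S A) h x :
  next_state P (rcons h x) = P x.1 x.2.
Proof. by case: h => //= y h; rewrite last_rcons. Qed.

(** Almost every trajectory only makes transitions of positive probability, so it is enough to know
    the discounted sum on those; the expectation then reduces to a finite sum. *)
Lemma one_step_return (gamma : R) (pi : policy M) (P : transitions R S A)
    (G : S -> A -> S -> R) :
  0 < gamma < 1 ->
  (forall w : nat -> S * A, init M (w 0%N).1 != 0 ->
    (forall n, P (w n).1 (w n).2 (w n.+1).1 != 0) ->
    limn [series gamma ^+ t * reward M (w t).1 (w t).2 (w t.+1).1]_t =
    G (w 0%N).1 (w 0%N).2 (w 1%N).1) ->
  discounted_return gamma pi P =
  (\sum_s init M s * \sum_a pi [::] s a * \sum_s' P s a s' * G s a s')%:E.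
Proof.
move=> g01 limG.
have law : is_path_law (step pi P) (traj_law pi P).
  by rewrite /traj_law; case: cid.
pose H (x y : S * A) := G x.1 x.2 y.1.
transitivity ('E_(traj_law pi P)[fun w => H (w 0%N) (w 1%N)])%E.
  rewrite /discounted_return unlock; apply: ae_eq_integral => //.
  - by apply/measurable_EFinP; exact: measurable_discounted_sum.
  - apply/measurable_EFinP.
    pose K (h : seq (S * A)) := H (nth (point0 M) h 0) (nth (point0 M) h 1).
    apply: (eq_measurable_fun
      (fun w : path_type (point0 M) => K (mkseq w 2))) => //.
    exact: measurable_fun_prefix.
  - apply: filterS (path_law_ae_neq0 law) => w w0 _ /=; congr (_%:E).
    have nz n : next_state P (mkseq w n) (w n).1 != 0.
      by apply: contra_neq (w0 n); rewrite /= /step_val => ->; rewrite mul0r.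
    apply: limG => [|n]; first exact: (nz 0%N).
    by have := nz n.+1; rewrite mkseqS next_state_rcons.
rewrite (expectation_prefix2 law); congr (_%:E).
under [RHS]eq_bigr do rewrite mulr_sumr.
rewrite pair_bigA; apply: eq_bigr => -[s a] _.
rewrite /= /step_val /= -mulrA; congr (_ * (_ * _)).
(* [G] ignores the second action [a'], whose probabilities sum to 1. *)
transitivity (\sum_s' \sum_a' P s a s' * pi [:: (s, a)] s' a' * G s a s').
  by rewrite pair_bigA.
apply: eq_bigr => s' _.
by rewrite -mulr_suml -mulr_sumr dist_sum1 mulr1.
Qed.

End returns.

(** * Sums over three states and continuity into a product space *)

Lemma big_option_bool (V : nmodType) (F : option bool -> V) :
  \sum_s F s = F None + F (Some true) + F (Some false).
Proof.
rewrite (bigD1 None) // (bigD1 (Some true)) // (bigD1 (Some false)) //=.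
by rewrite big1 ?addr0 ?addrA // => -[[]|].
Qed.

(** The pointwise topology is the supremum of those induced by the evaluations, which are surjective
    thanks to constant functions. *)
Lemma continuous_ptws (I : Type) (T U : topologicalType)
    (f : T -> {ptws I -> U}) :
  (forall i, continuous (fun x => f x i)) -> continuous f.
Proof.
move=> fc x; apply/cvg_sup => i; apply/cvg_image.
  by apply/seteqP; split => // y _; exists (fun=> y).
move=> B /fc Bi; exists (@^~ i @^-1` B) => //.
by apply/seteqP; split => [_ [g + <-]|y By] //; exists (fun=> y).
Qed.

(** * The robust MDP with a delayed payoff *)

Section counterexample.
Context (R : realType).

(* [None] is the initial state, [Some true] the state that delays the payoff by
   one step, and [Some false] the absorbing state. *)
Definition trans_mass (l : R) (s s' : option bool) : R :=
  match s, s' with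
  | None, Some true => 1 - l
  | None, Some false => l
  | Some _, Some false => 1
  | _, _ => 0
  end.

Lemma trans_mass_ge0 l s s' : 0 <= l <= 1 -> 0 <= trans_mass l s s'.
Proof.
by move=> /andP[l0 l1]; case: s s' => [?|] [[]|] //=; rewrite ?ler01 ?subr_ge0.
Qed.

Lemma trans_mass_sum1 l s : \sum_s' trans_mass l s s' = 1.
Proof.
by rewrite big_option_bool; case: s => [?|] /=; rewrite !add0r // subrK.
Qed.

Definition trans_kernel (l : R) (l01 : 0 <= l <= 1) :
    transitions R (option bool) bool :=
  fun s _ => Dist (fun s' => trans_mass_ge0 s s' l01) (trans_mass_sum1 l s).

(** A single [l] serves both actions: the adversary cannot react to the action drawn, which is why
    randomizing pays. *)
Definition trans_set : set (transitions R (option bool) bool) :=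
  [set P | exists2 l : R, 0 <= l <= 1 &
    forall s a s', P s a s' = trans_mass l s s'].

Lemma trans_kernel_in l (l01 : 0 <= l <= 1) : trans_set (trans_kernel l01).
Proof. by exists l. Qed.

Definition mass_coords (l : R) : {ptws option bool * bool * option bool -> R} :=
  fun k => trans_mass l k.1.1 k.2.

(** Compactness and polyhedrality are both read off this parametrization by a segment. *)
Lemma coords_trans_set :
  @coords R _ _ @` trans_set = mass_coords @` [set` `[0, 1]].
Proof.
apply/seteqP; split => [_ [P [l l01 PE] <-]|_ [l + <-]] /=.
  exists l; first by rewrite /= in_itv.
  by apply/funext => k; rewrite /coords PE.
rewrite set_itvcc => l01.
by exists (trans_kernel l01) => //; exact: trans_kernel_in.
Qed.

Lemma trans_set_compact : compact (@coords R _ _ @` trans_set).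
Proof.
rewrite coords_trans_set.
apply: continuous_compact; last exact: segment_compact.
apply/continuous_subspaceT/continuous_ptws => -[[s a] s'] l.
rewrite /mass_coords /=.
case: s s' => [b|] [[]|] /=; try exact: cvg_cst.
- by apply: cvgB; [exact: cvg_cst|exact: cvg_id].
- exact: cvg_id.
Qed.

Lemma trans_set_neq0 : trans_set !=set0.
Proof.
have l01 : 0 <= (0 : R) <= 1 by rewrite lexx ler01.
by exists (trans_kernel l01); exact: trans_kernel_in.
Qed.

Lemma point_mass_ge0 (s : option bool) : 0 <= (s == None)%:R :> R.
Proof. exact: ler0n. Qed.

Lemma point_mass_sum1 : \sum_(s : option bool) (s == None)%:R = 1 :> R.
Proof. by rewrite big_option_bool !addr0. Qed.

Definition delay_reward (s : option bool) (a : bool) (s' : option bool) : R :=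
  match s, s' with
  | None, Some true => - a%:R
  | None, Some false => a%:R
  | Some true, _ => 1
  | _, _ => 0
  end.

Lemma option_bool_gt0 : (0 < #|{: option bool}|)%N.
Proof. by rewrite card_option. Qed.

Lemma bool_gt0 : (0 < #|{: bool}|)%N.
Proof. by rewrite card_bool. Qed.

Definition delay_rmdp : rmdp R :=
  Rmdp option_bool_gt0 bool_gt0 delay_reward trans_set_neq0 trans_set_compact
       (Dist point_mass_ge0 point_mass_sum1).

(** Only the row of [None] depends on [l], so the parameter chosen at [None] also fits the other
    states. *)
Lemma delay_rectangular : s_rectangular delay_rmdp.
Proof.
exists (fun s => [set p | exists2 l : R, 0 <= l <= 1 &
  forall a s', p a s' = trans_mass l s s']).
apply/seteqP; split => P /=.
  by move=> [l l01 PE] s; exists l.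
move=> PU; have [l l01 PE] := PU None.
exists l => // -[b|] a s'; last exact: PE.
by have [l' _ ->] := PU (Some b).
Qed.

Let triple : finType := (option bool * bool * option bool)%type.
Let k0 : triple := (None, true, Some false).

(* The coordinates are affine functions of the coordinate [k0], which ranges
   over [0, 1]; each equality and bound gives two inequalities. *)
Let slope (k : triple) : R := mass_coords 1 k - mass_coords 0 k.

Let mass_coordsE l k : mass_coords l k = mass_coords 0 k + slope k * l.
Proof.
by case: k => -[[b|] a] [[]|] //=; rewrite /slope /mass_coords /=; ring.
Qed.

Lemma delay_polyhedral : polyhedral delay_rmdp.
Proof.
pose I : finType := (option triple * bool)%type.
(* Index [Some k1] encodes the affine equation for the coordinate [k1], index [None] the bounds on
   the coordinate [k0]; the boolean selects one of the two inequalities. *)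
pose c (i : I) (k : triple) : R :=
  let a := if i.1 is Some k1 then (k == k1)%:R - slope k1 * (k == k0)%:R
           else (k == k0)%:R in
  if i.2 then a else - a.
pose b (i : I) : R :=
  match i with
  | (Some k1, true) => mass_coords 0 k1
  | (Some k1, false) => - mass_coords 0 k1
  | (None, true) => 1
  | (None, false) => 0
  end.
have sum_delta (x : triple -> R) k1 : \sum_k (k == k1)%:R * x k = x k1.
  rewrite (bigD1 k1) //= eqxx mul1r big1 ?addr0 // => k /negbTE ->.
  by rewrite mul0r.
have sum_c (x : triple -> R) i : \sum_k c i k * x k =
    let a := if i.1 is Some k1 then x k1 - slope k1 * x k0 else x k0 in
    if i.2 then a else - a.
  have sum_eq k1 : \sum_k ((k == k1)%:R - slope k1 * (k == k0)%:R) * x k =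
      x k1 - slope k1 * x k0.
    under eq_bigr do rewrite mulrBl -mulrA.
    by rewrite sumrB -mulr_sumr !sum_delta.
  case: i => -[k1|] []; rewrite /c /= ?sum_eq ?sum_delta //.
  - by under eq_bigr do rewrite mulNr; rewrite sumrN sum_eq.
  - by under eq_bigr do rewrite mulNr; rewrite sumrN sum_delta.
exists #|I|, (fun i => c (enum_val i)), (fun i => b (enum_val i)).
rewrite [LHS]coords_trans_set; apply/seteqP; split => [_ [l + <-] i|x xc] /=.
  rewrite set_itvcc /= sum_c => /andP[l0 l1].
  case: (enum_val i) => -[k1|] [] //=; rewrite ?oppr_le0 //.
  - by rewrite mass_coordsE addrK.
  - by rewrite mass_coordsE addrK.
have {}xc i : (if i.2 then id else -%R)
    (if i.1 is Some k1 then x k1 - slope k1 * x k0 else x k0) <= b i.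
  by have := xc (enum_rank i); rewrite enum_rankK sum_c; case: i.2.
(* The coordinate [k0] of [mass_coords l] is [l] itself. *)
exists (x k0).
  have := xc (None, true); have := xc (None, false).
  by rewrite /= in_itv /= oppr_le0 => -> ->.
apply/funext => k; rewrite mass_coordsE.
have := xc (Some k, true); have := xc (Some k, false).
by rewrite /= lerN2 => h1 h2; lra.
Qed.

(** A possible trajectory leaves [None] at once and is in [Some false] from time 2 on, so at most
    two rewards are nonzero. *)
Lemma delay_return (gamma l : R) (pi : policy delay_rmdp)
    (P : transitions R (option bool) bool) :
  0 < gamma < 1 -> (forall s a s', P s a s' = trans_mass l s s') ->
  @discounted_return R delay_rmdp gamma pi P =
  (l * pi [::] None true + (1 - l) * (gamma - pi [::] None true))%:E.
Proof.
move=> g01 PE.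
(* The second summand is the reward 1 earned at time 1 when passing through [Some true]. *)
pose G (s : option bool) (a : bool) (s' : option bool) : R :=
  delay_reward s a s' + gamma * (s' == Some true)%:R.
rewrite (@one_step_return _ delay_rmdp _ _ _ G) //.
  congr (_%:E); rewrite /= !big_option_bool /= !mul0r !addr0 mul1r.
  rewrite big_bool /= !big_option_bool !PE /G /=.
  have := dist_sum1 (pi [::] None).
  rewrite big_bool /= => /(canRL (addKr _)) ->.
  by ring.
move=> w w0 wP.
have w0N : (w 0%N).1 = None.
  by apply/eqP; move: w0; rewrite /= pnatr_eq0 eqb0 negbK.
have wS n : (w n).1 != None -> (w n.+1).1 = Some false.
  have := wP n; rewrite PE; case: (w n).1 => [b|] // + _.
  by case: (w n.+1).1 => [[]|] //=; rewrite eqxx.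
have w1N : (w 1%N).1 != None.
  have := wP 0%N; rewrite PE w0N.
  by case: (w 1%N).1 => [b|] //=; rewrite eqxx.
have w2 n : (w n.+2).1 = Some false.
  by elim: n => [|n IH]; apply: wS; rewrite ?IH.
apply: lim_near_cst; first exact: norm_hausdorff.
(* The partial sums are constant from index 2 on. *)
exists 2%N => // -[|[|n]] //= _.
rewrite /series /= !big_nat_recl //= big1 => [|i _]; last first.
  by rewrite w2 mulr0.
rewrite w0N addr0 expr0 mul1r expr1 /G; congr (_ + gamma * _).
by case: (w 1%N).1 w1N => [[]|].
Qed.

(* The return is affine in [l], hence minimal at an endpoint of [0, 1]. *)
Lemma delay_worst_return (gamma : R) (pi : policy delay_rmdp) : 0 < gamma < 1 ->
  let v := (Num.min (pi [::] None true) (gamma - pi [::] None true))%:E in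
  worst_return gamma pi = v /\
  exists2 P, uncertainty delay_rmdp P & discounted_return gamma pi P = v.
Proof.
move=> g01 v; set p := pi [::] None true in v *.
have attained : exists2 P, uncertainty delay_rmdp P &
    discounted_return gamma pi P = v.
  (* The adversary puts all the mass on the smaller of [p] ([l = 1]) and [gamma - p] ([l = 0]). *)
  pose l : R := (p <= gamma - p)%R%:R.
  have l01 : 0 <= l <= 1 by rewrite /l; case: (p <= _); rewrite lexx ler01.
  exists (trans_kernel l01); first exact: trans_kernel_in.
  rewrite (@delay_return _ l) // -/p /v /l; congr (_%:E).
  by case: leP => _ /=; ring.
split=> //; apply/le_anti/andP; split.
  by have [P PU <-] := attained; apply: ereal_inf_lbound; exists P.
apply: le_ereal_inf_tmp => _ [P [l /andP[l0 l1] PE] <-].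
rewrite (@delay_return _ l) ?l0 // -/p lee_fin.
set m := Num.min _ _.
have mp : m <= p by rewrite /m ge_min lexx.
have mg : m <= gamma - p by rewrite /m ge_min lexx orbT.
(* The return is a convex combination of two numbers that are at least [m]. *)
nra.
Qed.

Definition coin_mass (p : R) (a : bool) : R := if a then p else 1 - p.

Lemma coin_mass_ge0 p a : 0 <= p <= 1 -> 0 <= coin_mass p a.
Proof. by case: a => /andP[p0 p1] //=; rewrite subr_ge0. Qed.

Lemma coin_mass_sum1 p : \sum_a coin_mass p a = 1.
Proof. by rewrite big_bool /= subrKC. Qed.

Lemma delay_optimal_return (gamma : R) : 0 < gamma < 1 ->
  ((gamma / 2)%:E <= optimal_return delay_rmdp gamma)%E.
Proof.
move=> g01; have /andP[g0 g1] := g01.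
have p01 : 0 <= gamma / 2 <= 1 by lra.
(* With [p = gamma / 2], both arguments of the minimum equal [gamma / 2]. *)
pose pi : policy delay_rmdp := fun _ _ =>
  Dist (fun a => coin_mass_ge0 a p01) (coin_mass_sum1 (gamma / 2)).
apply: le_ereal_sup_tmp; exists (worst_return gamma pi); first by exists pi.
rewrite (delay_worst_return pi g01).1 lee_fin /= le_min lexx /=.
lra.
Qed.

(** If [p] differs from [gamma / 2], one of [p] and [gamma - p] lies strictly below their mean
    [gamma / 2]. *)
Lemma delay_suboptimal (pi : policy delay_rmdp) (gamma : R) : 0 < gamma < 1 ->
  pi [::] None true != gamma / 2 ->
  (worst_return gamma pi < optimal_return delay_rmdp gamma)%E.
Proof.
move=> g01 pN; apply: lt_le_trans (delay_optimal_return g01).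
rewrite (delay_worst_return pi g01).1 lte_fin gt_min.
by case: ltgtP pN => //= gp _; lra.
Qed.

End counterexample.

Theorem proposition4p27 (R : realType) :
  exists M : rmdp R,
    [/\ s_rectangular M,
        polyhedral M,
        (forall (pi : policy M) (gamma : R), 0 < gamma < 1 ->
           exists2 P, uncertainty M P &
             discounted_return gamma pi P = worst_return gamma pi),
        ~ (exists pi : policy M, blackwell_optimal pi) &
        forall (pi : policy M) (gamma : R), 0 < gamma < 1 ->
          exists2 gamma' : R, gamma < gamma' < 1 &
            (worst_return gamma' pi < optimal_return M gamma')%E].
Proof.
have subopt (pi : policy (delay_rmdp R)) (gamma : R) : 0 < gamma < 1 ->
    exists2 gamma' : R, gamma < gamma' < 1 &
      (worst_return gamma' pi < optimal_return (delay_rmdp R) gamma')%E.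
  (* Two distinct discount factors in [(gamma, 1)] suffice: the first-step probability of [pi]
     cannot be half of both. *)
  move=> /andP[g0 g1]; pose g' := (1 + gamma) / 2; pose g'' := (1 + g') / 2.
  have [pE|pN] := eqVneq (pi [::] None true) (g' / 2).
    exists g''; first by rewrite /g'' /g'; lra.
    apply: delay_suboptimal; first by rewrite /g'' /g'; lra.
    by rewrite pE /g''; apply/eqP; rewrite /g' => E; lra.
  by exists g'; [|apply: delay_suboptimal => //]; rewrite /g'; lra.
exists (delay_rmdp R); split => //.
- exact: delay_rectangular.
- exact: delay_polyhedral.
- move=> pi gamma g01; have [-> [P PU PE]] := delay_worst_return pi g01.
  by exists P.
- move=> [pi [gamma [g01 opt]]].
  have [gamma' g'] := subopt pi gamma g01.
  by rewrite ltNge opt.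
Qed.
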